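(* Let $f:\{-1,1\}^n\to\{-1,1\}$ be low-correlation self-predicting, and let $n_f=|\{i\in[n]:\hat f_{\{i\}}\neq0\}|$, assumed $\ge1$. Then $f$ is $\sqrt{\frac{2}{\pi n_f}}$-close to a linear threshold function, i.e., there is a linear threshold function $g$ with $\Pr(f(X^n)\ne g(X^n))\le\sqrt{2/(\pi n_f)}$, $X^n$ uniform on $\{-1,1\}^n$.
   Context: $\hat f_S=\mathbb{E}[f(X^n)\prod_{i\in S}X_i]$. A linear threshold function is $g(x^n)=\operatorname{sgn}(a_0+\sum_{i=1}^n a_ix_i)$ with real coefficients chosen so that $a_0+\sum_i a_ix_i\neq0$ for all $x^n\in\{-1,1\}^n$. For $\rho\in[0,1]$, $T_\rho f(y^n)=\sum_{S\subseteq[n]}\rho^{|S|}\hat f_S\prod_{i\in S}y_i$; $\operatorname{sgn}(0)=0$; $f$ is $\rho$-SP if $f(y^n)=\operatorname{sgn}T_\rho f(y^n)$ whenever $T_\rho f(y^n)\ne0$; $f$ is low-correlation self-predicting if there is $\rho^*>0$ with $f$ $\rho$-SP for all $\rho\in[0,\rho^* )$. *)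

(* Defs.v *)
From HB Require Import structures.
From mathcomp Require Import all_boot all_order all_algebra.
From mathcomp Require Import reals trigo.

Set Implicit Arguments.
Unset Strict Implicit.
Unset Printing Implicit Defensive.

Import Order.TTheory GRing.Theory Num.Theory.

Local Open Scope ring_scope.

(* Elements of {-1,1} are encoded by booleans: b stands for (-1) ^+ b, that is,
   false for 1 and true for -1. *)
Definition cube (n : nat) := {ffun 'I_n -> bool}.

Definition spin (R : realType) (b : bool) : R := (-1) ^+ b.
Arguments spin R b : clear implicits.

Definition expect (R : realType) (n : nat) (F : cube n -> R) : R :=
  (\sum_(x : cube n) F x) / #|{: cube n}|%:R.

Definition prob (R : realType) (n : nat) (A : pred (cube n)) : R :=
  #|A|%:R / #|{: cube n}|%:R.
Arguments prob R {n} A.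

Definition chi (R : realType) (n : nat) (S : {set 'I_n}) (x : cube n) : R :=
  \prod_(i in S) spin R (x i).
Arguments chi R {n} S x.

Definition fourier (R : realType) (n : nat) (f : cube n -> bool)
    (S : {set 'I_n}) : R :=
  expect (fun x => spin R (f x) * chi R S x).
Arguments fourier R {n} f S.

Definition noise_op (R : realType) (n : nat) (rho : R) (f : cube n -> bool)
    (y : cube n) : R :=
  \sum_(S : {set 'I_n}) rho ^+ #|S| * fourier R f S * chi R S y.

Definition self_predicting (R : realType) (n : nat) (rho : R)
    (f : cube n -> bool) : Prop :=
  forall y : cube n, noise_op rho f y != 0 ->
    spin R (f y) = Num.sg (noise_op rho f y).

(* noise_op is only meaningful for rho in [0, 1], hence the bound rho <= 1. *)
Definition low_corr_self_predicting (R : realType) (n : nat)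
    (f : cube n -> bool) : Prop :=
  exists rhos : R, 0 < rhos /\
    forall rho : R, 0 <= rho <= 1 -> rho < rhos -> self_predicting rho f.
Arguments low_corr_self_predicting R {n} f.

Definition affine_form (R : realType) (n : nat) (a0 : R) (a : 'I_n -> R)
    (x : cube n) : R :=
  a0 + \sum_(i < n) a i * spin R (x i).

Definition linear_threshold (R : realType) (n : nat) (g : cube n -> bool)
    : Prop :=
  exists (a0 : R) (a : 'I_n -> R),
    (forall x, affine_form a0 a x != 0) /\
    (forall x, spin R (g x) = Num.sg (affine_form a0 a x)).
Arguments linear_threshold R {n} g.

Definition nlin (R : realType) (n : nat) (f : cube n -> bool) : nat :=
  #|[set i : 'I_n | fourier R f [set i] != 0]|.
Arguments nlin R {n} f.

(* Main.v *)
Require Import Defs.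
From mathcomp Require Import all_boot all_order all_algebra.
From mathcomp Require Import reals trigo.
From mathcomp Require Import ring lra.
Set Implicit Arguments.
Unset Strict Implicit.
Import Order.TTheory GRing.Theory Num.Theory.
Local Open Scope ring_scope.

(** Taking rho = 0 shows that the mean of f vanishes (otherwise f would be
    constant and have no degree-1 coefficient).  Hence the noise operator is
    rho * L + O(rho^2), where L is the degree-1 part of f, and f = sgn L off the
    zero set A of L.  The thresholds sgn (L + e) and sgn (L - e), for small e,
    disagree exactly on A, so one of them differs from f on at most half of A.

    To bound A, correlate sgn L with D = sum of sgn(a_i) x_i over the m relevant
    coordinates.  Raising sgn(a_i) x_i from -1 to 1 never lowers
    sgn L, and raises it by 1 when one end of the edge lies in A, so
    E[sgn L * D] >= m P(A); on the other hand E|D| <= sqrt m.  Thus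
    P(A) <= 1 / sqrt m, and 1 / (2 sqrt m) <= sqrt (2 / (pi m)) as pi <= 8. *)

Section Cube.
Variables (R : realType) (n : nat).
Implicit Types (x y : cube n) (i j : 'I_n) (a : 'I_n -> R).

(** * Spins, coordinate flips and orthogonality *)

Lemma spinM (b : bool) : spin R b * spin R b = 1.
Proof. by case: b; rewrite /spin ?expr1 ?expr0 ?mulrNN mulr1. Qed.

Lemma normr_spin (b : bool) : `|spin R b| = 1.
Proof. by rewrite normr_sign. Qed.

Lemma sgr_spin (b : bool) : Num.sg (spin R b) = spin R b.
Proof. by case: b; rewrite /spin ?expr1 ?sgrN sgr1. Qed.

Lemma spin_inj : injective (spin R).
Proof. by case=> -[] //; rewrite /spin expr0 expr1 => ?; exfalso; lra. Qed.

Lemma card_cube_gt0 : 0 < #|{: cube n}|%:R :> R.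
Proof. by rewrite ltr0n; apply/card_gt0P; exists [ffun=> false]. Qed.

Definition flip i x : cube n := [ffun j => x j (+) (j == i)].

Lemma flipK i : involutive (flip i).
Proof. by move=> x; apply/ffunP=> j; rewrite !ffunE -addbA addbb addbF. Qed.

Lemma spin_flip i x : spin R (flip i x i) = - spin R (x i).
Proof. by rewrite ffunE eqxx addbT /spin signrN. Qed.

Lemma spin_flip_neq i j x : j != i -> spin R (flip i x j) = spin R (x j).
Proof. by move=> /negbTE ji; rewrite ffunE ji addbF. Qed.

Lemma sum_flip i (F : cube n -> R) : \sum_x F x = \sum_x F (flip i x).
Proof. exact: reindex_inj (can_inj (flipK i)). Qed.

Lemma sum_spin i : \sum_(x : cube n) spin R (x i) = 0.
Proof.
have := sum_flip i (fun x => spin R (x i)).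
under [in RHS]eq_bigr do rewrite spin_flip.
rewrite sumrN; lra.
Qed.

Lemma sum_spinM i j :
  \sum_(x : cube n) spin R (x i) * spin R (x j) = #|{: cube n}|%:R *+ (i == j).
Proof.
have [<-|ij] := eqVneq i j.
  under eq_bigr do rewrite spinM.
  by rewrite sumr_const.
(* Flipping [i] alone negates the product, so the sum equals its own opposite. *)
have := sum_flip i (fun x => spin R (x i) * spin R (x j)).
under [in RHS]eq_bigr do rewrite spin_flip spin_flip_neq 1?eq_sym // mulNr.
rewrite sumrN mulr0n; lra.
Qed.

(** * Linear forms and the number of their zeros *)

Definition lin_form a x : R := \sum_i a i * spin R (x i).

(** Parseval in degree one: once the square is expanded, orthogonality of the spins kills the cross
    terms. *)
Lemma sum_sqr_lin_form a :
  \sum_x lin_form a x ^+ 2 = #|{: cube n}|%:R * \sum_i a i ^+ 2.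
Proof.
under eq_bigr => x _.
  rewrite expr2 /lin_form big_distrlr /=.
  over.
rewrite exchange_big mulr_sumr; apply: eq_bigr => i _ /=.
rewrite exchange_big (bigD1 i) //= [X in _ + X]big1 => [|j ji].
  under eq_bigr do rewrite mulrACA.
  by rewrite -mulr_sumr sum_spinM eqxx addr0 mulrC expr2.
under eq_bigr do rewrite mulrACA.
by rewrite -mulr_sumr sum_spinM eq_sym (negbTE ji) mulr0.
Qed.

Lemma lin_form_flip a i x :
  lin_form a (flip i x) = lin_form a x - 2 * (a i * spin R (x i)).
Proof.
rewrite /lin_form (bigD1 i) //= [in RHS](bigD1 i) //= spin_flip.
have -> : \sum_(j | j != i) a j * spin R (flip i x j) =
          \sum_(j | j != i) a j * spin R (x j).
  by apply: eq_bigr => j ji; rewrite spin_flip_neq.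
ring.
Qed.

(* Applied with u = L x and v = a_i x_i, so that u - 2 v is the value of L after
   flipping coordinate i. *)
Lemma sg_jump (u v : R) : v != 0 ->
  (u == 0)%:R + (u - 2 * v == 0)%:R <= Num.sg v * (Num.sg u - Num.sg (u - 2 * v)).
Proof.
move=> v0; case: (sgrP v) v0 => // v0 _; case: (sgrP u) => u0;
  case: (sgrP (u - 2 * v)) => w0 /=; rewrite ?(gt_eqF u0) ?(lt_eqF u0) ?u0 ?eqxx;
  rewrite ?(gt_eqF w0) ?(lt_eqF w0) ?w0 ?eqxx /= ?mulr0n ?mulr1n; lra.
Qed.

Lemma card_zeros_le_corr a i : a i != 0 ->
  #|[pred x | lin_form a x == 0]|%:R <=
  \sum_x Num.sg (lin_form a x) * (Num.sg (a i) * spin R (x i)).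
Proof.
move=> ai0; set T := \sum_x _; set A := _%:R.
have EA : A = \sum_x (lin_form a x == 0)%:R.
  by rewrite /A -sum1_card natr_sum big_mkcond; apply: eq_bigr => x _; rewrite inE; case: eqP.
(* Write one copy of each side as it stands and reindex the other by [flip i]: the summand at [x]
   then sees both ends of an edge, where [sg_jump] applies. *)
suff: A + A <= T + T by lra.
have EA' := EA; rewrite (sum_flip i) in EA'.
have ET : T = \sum_x _ := sum_flip i _.
rewrite {1}EA EA' {2}ET {1}/T -!big_split /=; apply: ler_sum => x _.
have v0 : a i * spin R (x i) != 0 by rewrite mulf_neq0 // /spin signr_eq0.
have := sg_jump (lin_form a x) v0.
rewrite !lin_form_flip spin_flip sgrM sgr_spin.
set p := (_ == 0)%:R; set q := (_ == 0)%:R; lra.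
Qed.

Lemma card_zeros_lin_form a :
  #|[pred x | lin_form a x == 0]|%:R * Num.sqrt #|[set i | a i != 0]|%:R <=
  #|{: cube n}|%:R :> R.
Proof.
set A := #|[pred x | _]|%:R; set m := #|[set i | _]|; set N := #|{: cube n}|%:R.
have [m0|m_gt0] := posnP m.
  by rewrite m0 sqrtr0 mulr0 ler0n.
set s := Num.sqrt _.
have s_gt0 : 0 < s by rewrite sqrtr_gt0 ltr0n.
have ss : s * s = m%:R by rewrite -expr2 sqr_sqrtr // ler0n.
pose D := lin_form (fun i => Num.sg (a i)).
(* Sum [card_zeros_le_corr] over the [m] coordinates with [a i != 0]; the others drop out of [D]
   because [Num.sg 0 = 0]. *)
have lb : A * m%:R <= \sum_x Num.sg (lin_form a x) * D x.
  have -> : \sum_x Num.sg (lin_form a x) * D x =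
      \sum_i \sum_x Num.sg (lin_form a x) * (Num.sg (a i) * spin R (x i)).
    by rewrite exchange_big; apply: eq_bigr => x _; rewrite mulr_sumr.
  rewrite (bigID (fun i => a i != 0)) /= [X in _ <= _ + X]big1 => [|i]; last first.
    rewrite negbK => /eqP ->; rewrite big1 // => x _.
    by rewrite sgr0 mul0r mulr0.
  rewrite addr0 mulr_natr /m -sumr_const big_mkcond [leRHS]big_mkcond /=.
  apply: ler_sum => i _; rewrite inE; case: ifP => // ai0.
  exact: card_zeros_le_corr.
(* AM-GM: 2 s |D x| <= D x ^ 2 + m, and the second moment of D is m *)
have ub : s * (\sum_x Num.sg (lin_form a x) * D x) *+ 2 <= N * m%:R *+ 2.
  have -> : N * m%:R *+ 2 = \sum_x (D x ^+ 2 + m%:R).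
    rewrite big_split /= sum_sqr_lin_form sumr_const -/N.
    have -> : \sum_i Num.sg (a i) ^+ 2 = m%:R.
      rewrite /m -sum1_card natr_sum big_mkcond [RHS]big_mkcond.
      by apply: eq_bigr => i _ /=; rewrite inE sqr_sg; case: (a i != 0).
    by rewrite -[m%:R *+ _]mulr_natl mulr2n.
  rewrite mulr_sumr -sumrMnl; apply: ler_sum => x _.
  (* The square of [s - Num.sg (lin_form a x) * D x] has last term [D x ^+ 2] only if the sign
     squares to 1, so zeros of the form are treated apart. *)
  have [h1|h0] := eqVneq (lin_form a x) 0.
    by rewrite h1 sgr0 mul0r mulr0 mul0rn addr_ge0 ?sqr_ge0.
  have hh : Num.sg (lin_form a x) ^+ 2 = 1 by rewrite sqr_sg h0.
  have := sqr_ge0 (s - Num.sg (lin_form a x) * D x).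
  by rewrite sqrrB exprMn hh mul1r [s ^+ 2]expr2 ss; lra.
have : (A * s) * m%:R <= N * m%:R.
  have : s * (A * m%:R) <= s * (\sum_x Num.sg (lin_form a x) * D x).
    by rewrite ler_pM2l.
  lra.
by rewrite ler_pM2r ?ltr0n.
Qed.

(** * Linear thresholds from sign agreement *)

Lemma nonzero_gap (F : cube n -> R) :
  exists2 e, 0 < e & forall x, F x != 0 -> e < `|F x|.
Proof.
suff [e e0 he] : exists2 e, 0 < e &
    forall x, x \in enum {: cube n} -> F x != 0 -> e < `|F x|.
  by exists e => // x; apply: he; rewrite mem_enum.
elim: (enum _) => [|y s [e e0 he]]; first by exists 1.
have [Fy|Fy] := eqVneq (F y) 0.
  exists e => // x; rewrite inE => /orP[/eqP->|]; last exact: he.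
  by rewrite Fy eqxx.
have Fy0 : 0 < `|F y| by rewrite normr_gt0.
exists (Num.min e (`|F y| / 2)); first by rewrite lt_min e0 divr_gt0.
move=> x; rewrite inE gt_min => /orP[/eqP->|xs] h.
  by apply/orP; right; lra.
by rewrite he.
Qed.

Lemma sgr_perturb (u v : R) : `|v| < `|u| -> Num.sg (u + v) = Num.sg u.
Proof.
move=> vu; have /andP[v1 v2] : - `|u| < v < `|u| by rewrite -ltr_norml.
case: (ltgtP u 0) v1 v2 vu => [u0|u0|->].
- by rewrite ltr0_norm // => *; rewrite !ltr0_sg //; lra.
- by rewrite gtr0_norm // => *; rewrite !gtr0_sg //; lra.
- by rewrite normr0 => *; exfalso; lra.
Qed.

Lemma normr_chi (S : {set 'I_n}) x : `|chi R S x| = 1.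
Proof. by rewrite /chi normr_prod big1 // => i _; apply: normr_spin. Qed.

(* sgn (L + e) and sgn (L - e) differ exactly on the zeros of L, so on that set
   one of them errs at most half of the time. *)
Lemma threshold_of_sign_agreement a (f : cube n -> bool) :
  (forall x, lin_form a x != 0 -> spin R (f x) = Num.sg (lin_form a x)) ->
  exists g, linear_threshold R g /\
    (#|[pred x | f x != g x]|.*2 <= #|[pred x | lin_form a x == 0%R]|)%N.
Proof.
move=> fL; have [e e0 he] := nonzero_gap (lin_form a).
(* As [true] encodes -1, this test returns the code of the sign. The offset [spin R b * e] makes
   [g b] equal to [b] on the zeros of the form. *)
pose g (b : bool) x := Num.sg (spin R b * e + lin_form a x) == -1.
have aff b x : affine_form (spin R b * e) a x = spin R b * e + lin_form a x by [].
have ne b : `|spin R b * e| = e by rewrite normrM normr_spin mul1r gtr0_norm.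
have gL b x : lin_form a x != 0 ->
    Num.sg (spin R b * e + lin_form a x) = Num.sg (lin_form a x).
  by move=> Lx; rewrite addrC sgr_perturb // ne he.
have g0 b x : lin_form a x == 0 -> Num.sg (spin R b * e + lin_form a x) = spin R b.
  by move=> /eqP ->; rewrite addr0 sgrM (gtr0_sg e0) mulr1 sgr_spin.
have gE b x : spin R (g b x) = Num.sg (spin R b * e + lin_form a x).
  rewrite /g; have [Lx|Lx] := boolP (lin_form a x == 0).
    by rewrite g0 //; case: b; rewrite /spin ?expr1 ?eqxx // expr0;
       case: eqP => // ?; exfalso; lra.
  rewrite gL //; case: sgrP Lx => // Lx _; last by rewrite eqxx /spin expr1.
  by rewrite (_ : (1 == -1 :> R) = false) //; apply/eqP => ?; lra.
have glt b : linear_threshold R (g b).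
  exists (spin R b * e), a; split=> x; last by rewrite gE.
  by rewrite aff -sgr_eq0 -gE /spin signr_eq0.
have gf b x : lin_form a x != 0 -> g b x = f x.
  by move=> Lx; apply: spin_inj; rewrite gE gL // fL.
have gb b x : lin_form a x == 0 -> g b x = b.
  by move=> Lx; apply: spin_inj; rewrite gE g0.
(* On a zero, [g true] and [g false] take both values, so exactly one errs; elsewhere both agree
   with [f]. *)
have cnt : (#|[pred x | f x != g true x]| + #|[pred x | f x != g false x]| =
            #|[pred x | lin_form a x == 0%R]|)%N.
  rewrite -!sum1_card big_mkcond [X in (_ + X)%N]big_mkcond [RHS]big_mkcond.
  rewrite -big_split; apply: eq_bigr => x _; rewrite !inE.
  have [Lx|Lx] := boolP (lin_form a x == 0); first by rewrite !gb //; case: (f x).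
  by rewrite !gf // eqxx.
have [le|le] := leqP #|[pred x | f x != g true x]| #|[pred x | f x != g false x]|.
  by exists (g true); split=> //; rewrite -cnt -addnn leq_add2l.
by exists (g false); split=> //; rewrite -cnt -addnn leq_add2r ltnW.
Qed.

(** * The noise operator at small [rho] *)

Lemma noise_op0 (f : cube n -> bool) y : noise_op 0 f y = fourier R f set0.
Proof.
(* The convention [0 ^+ 0 = 1] keeps the term of the empty set. *)
rewrite /noise_op (bigD1 set0) //= cards0 expr0 mul1r big1 => [|S S0].
  by rewrite /chi big_set0 mulr1 addr0.
by rewrite expr0n cards_eq0 (negbTE S0) !mul0r.
Qed.

(** Singletons give exactly the linear term, the empty set contributes 0, and any larger [S] has
    [rho ^+ #|S| <= rho ^+ 2] since [rho <= 1]. The total absolute Fourier mass serves as [C]. *)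
Lemma noise_op_expansion (f : cube n -> bool) y : fourier R f set0 = 0 ->
  exists2 C, 0 <= C & forall rho : R, 0 <= rho <= 1 ->
    `|noise_op rho f y - rho * lin_form (fun i => fourier R f [set i]) y|
      <= C * rho ^+ 2.
Proof.
move=> f0; exists (\sum_S `|fourier R f S|) => [|rho /andP[r0 r1]].
  exact: sumr_ge0.
have -> : rho * lin_form (fun i => fourier R f [set i]) y =
    \sum_(S : {set 'I_n} | #|S| == 1%N) rho ^+ #|S| * fourier R f S * chi R S y.
  rewrite /lin_form mulr_sumr.
  rewrite (eq_bigl (fun S => S \in [set [set i] | i : 'I_n])) => [|S]; last first.
    apply/cards1P/imsetP => [[i ->]|[i _ ->]]; by exists i.
  rewrite big_imset /=; last by move=> i j _ _; apply: set1_inj.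
  by apply: eq_bigr => i _; rewrite cards1 expr1 /chi big_set1 mulrA.
rewrite /noise_op (bigID (fun S : {set 'I_n} => #|S| == 1%N)) /=.
rewrite addrAC subrr add0r mulr_suml.
apply: (le_trans (ler_norm_sum _ _ _)).
rewrite [X in _ <= X](bigID (fun S : {set 'I_n} => #|S| == 1%N)) /=.
rewrite ler_wpDl //; first by apply: sumr_ge0 => S _; rewrite mulr_ge0 ?sqr_ge0.
apply: ler_sum => S S1; rewrite normrM normr_chi mulr1 normrM mulrC.
have [->|S0] := eqVneq S set0; first by rewrite f0 normr0 !mul0r.
rewrite ler_wpM2l // normrX ger0_norm //; apply: ler_wiXn2l => //.
by rewrite ltn_neqAle eq_sym S1 card_gt0.
Qed.

Lemma low_corr_fourier0 (f : cube n -> bool) : low_corr_self_predicting R f ->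
  (0 < nlin R f)%N -> fourier R f set0 = 0.
Proof.
move=> [rs [rs0 sp]] /card_gt0P[i]; rewrite inE; apply: contra_neq_eq => f0.
have fc x : spin R (f x) = Num.sg (fourier R f set0).
  have /sp : 0 <= (0 : R) <= 1 by rewrite lexx ler01.
  by move=> /(_ rs0 x); rewrite noise_op0; apply.
rewrite /fourier /expect.
under eq_bigr do rewrite fc /chi big_set1.
by rewrite -mulr_sumr sum_spin mulr0 mul0r.
Qed.

Lemma low_corr_sg_lin_form (f : cube n -> bool) y :
  low_corr_self_predicting R f -> fourier R f set0 = 0 ->
  lin_form (fun i => fourier R f [set i]) y != 0 ->
  spin R (f y) = Num.sg (lin_form (fun i => fourier R f [set i]) y).
Proof.
set L := lin_form _ y; move=> [rs [rs0 sp]] f0 L0.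
have [C C0 hC] := noise_op_expansion y f0.
have L_gt0 : 0 < `|L| by rewrite normr_gt0.
have C1 : 0 < C + 1 by lra.
(* The bounds keep [r] in [0, 1], strictly below [rs], and small enough that [C * r ^+ 2 < r * |L|].
   Using [C + 1] avoids division by 0 and makes the last inequality strict. *)
pose r := Num.min 1 (Num.min (rs / 2) (`|L| / (C + 1))).
have r_gt0 : 0 < r by rewrite !lt_min ltr01 !divr_gt0.
have [r1 rrs rL] : [/\ r <= 1, r <= rs / 2 & r <= `|L| / (C + 1)].
  by rewrite /r !ge_min !lexx !orbT.
have {rL} rL : r * (C + 1) <= `|L| by rewrite -ler_pdivlMr.
have sgN : Num.sg (noise_op r f y) = Num.sg L.
  rewrite -[noise_op r f y](subrK (r * L)) addrC sgr_perturb.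
    by rewrite sgrM gtr0_sg ?mul1r.
  apply: le_lt_trans (hC r _) _; first by rewrite r1 ltW.
  by rewrite normrM gtr0_norm // expr2 mulrCA ltr_pM2l //; lra.
rewrite -sgN; apply: sp; [by rewrite r1 ltW|lra|].
by rewrite -sgr_eq0 sgN sgr_eq0.
Qed.

End Cube.

(** * The constant and the final estimate *)

Lemma pi_le4 (R : realType) : pi <= 4 :> R.
Proof. by have := pihalf_02 R => /andP[_]; lra. Qed.

(** After squaring, this amounts to [pi <= 8], so the crude bound [pi <= 4] suffices. *)
Lemma inv_sqrt_le_sqrt_pi (R : realType) (m : R) : 0 < m ->
  (2 * Num.sqrt m)^-1 <= Num.sqrt (2 / (pi * m)).
Proof.
move=> m0; have pi0 := pi_gt0 R.
have /ger0_norm <- : 0 <= (2 * Num.sqrt m)^-1.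
  by rewrite invr_ge0 mulr_ge0 // sqrtr_ge0.
rewrite -sqrtr_sqr ler_wsqrtr // exprVn exprMn sqr_sqrtr; last exact: ltW.
rewrite !invfM mulrA ler_pM2r ?invr_gt0 // ler_pdivlMr //.
have := pi_le4 R; lra.
Qed.

Unset Implicit Arguments.
Set Strict Implicit.

Theorem theorem5p10 (R : realType) (n : nat) (f : cube n -> bool)
    (hf : low_corr_self_predicting R f) (hn : (1 <= nlin R f)%N) :
  exists g : cube n -> bool,
    linear_threshold R g /\
    prob R [pred x | f x != g x] <= Num.sqrt (2 / (pi * (nlin R f)%:R)).
Proof.
have f0 := low_corr_fourier0 hf hn.
have [g [ltg card_g]] := threshold_of_sign_agreement
  (fun x => @low_corr_sg_lin_form R n f x hf f0).
exists g; split=> //; rewrite /prob ler_pdivrMr ?card_cube_gt0 //.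
have := card_zeros_lin_form (fun i => fourier R f [set i]).
move: card_g; rewrite -(ler_nat R) -muln2 natrM -/(nlin R f).
set m := (nlin R f)%:R; set N := #|cube n|%:R; set B := #|[pred x | f x != g x]|%:R.
set A := #|[pred x | _]|%:R.
move=> BA AN; have m0 : 0 < m by rewrite ltr0n.
have s0 : 0 < Num.sqrt m by rewrite sqrtr_gt0.
have le_rhs := inv_sqrt_le_sqrt_pi m0.
(* Combining [B * 2 <= A] with [A * Num.sqrt m <= N] bounds [B] by this middle term. *)
apply: le_trans (_ : (2 * Num.sqrt m)^-1 * N <= _); last first.
  by rewrite ler_wpM2r // ler0n.
rewrite mulrC ler_pdivlMr ?mulr_gt0 //.
apply: le_trans AN; by rewrite mulrA ler_wpM2r // ltW.
Qed.
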